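(* Let $m,k$ be integers with $1\le k\le m-1$, put $q=2^m$, $Q=2^k$, $g=\gcd(m,k)$, and assume that $m/g$ is odd. Let $a,b,c,d\in\mathbb{F}_q$ satisfy $ad+bc\neq0$. Then the map \[ G:\mathbb{F}_q^2\to\mathbb{F}_q^2,\qquad G(y,z)=\bigl(y^{Q+1}+ay+bz,\; z^{Q+1}+cy+dz\bigr) \] is not a permutation of $\mathbb{F}_q^2$.
   Context: A permutation of a finite set is a bijection of the set onto itself. *)

(* Defs.v *)
From mathcomp Require Import all_boot all_algebra.

Set Implicit Arguments.
Unset Strict Implicit.
Unset Printing Implicit Defensive.

Import GRing.Theory.
Local Open Scope ring_scope.

Definition Gmap (F : finFieldType) (Q : nat) (a b c d : F) (p : F * F) : F * F :=
  (p.1 ^+ (Q + 1) + a * p.1 + b * p.2, p.2 ^+ (Q + 1) + c * p.1 + d * p.2).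

(* Main.v *)
Require Import Defs.
From HB Require Import structures.
From mathcomp Require Import all_boot all_algebra all_field.
From mathcomp Require Import ring zify.

Import GRing.Theory.
Local Open Scope ring_scope.

(* Let sigma be the Frobenius x |-> x^Q, of odd order n = m/g on F, and let
   K be its fixed field.  Two points differing by (s, t) have the same image
   iff y sigma(s) + s sigma(y) + s sigma(s) + a s + b t = 0 and the analogous
   equation holds in z.  Dividing by s sigma(s) and using additive Hilbert 90,
   where tr 1 = n = 1, these are solvable iff (a s + b t) / (s sigma(s)) and
   (c s + d t) / (t sigma(t)) have trace 1 over K.  With t = s w this reads
   tr(A x) = tr(B x) = 1 for x = 1 / sigma(s), A = a + b w and
   B = (c + d w) / (w sigma(w)), so a collision exists as soon as A and B are
   K-independent, or equal and nonzero.  If there is no collision, A and B are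
   thus K-dependent for every w; replacing w by t w with t in K turns this into
   a quadratic identity in t.  When |K| > 2 its coefficients vanish, which
   forces sigma = id.  When |K| = 2, dependence means A = 0 or B = 0, which
   fails for some w. *)

Section TwistedMap.

Set Implicit Arguments.
Unset Strict Implicit.

Context {F : fieldType} (sigma : {rmorphism F -> F}) (n : nat).
Hypotheses (char2 : 2%N \in [pchar F]) (n_odd : odd n)
  (iter_sigma : forall x, iter n sigma x = x).

(** * Characteristic two and the trace down to the fixed field of [sigma] *)

Lemma two_eq0 : 2%:R = 0 :> F.
Proof. by case/andP: char2 => _ /eqP. Qed.

Lemma addr_eq0_char2 (x y : F) : (x + y == 0) = (x == y).
Proof. by rewrite addr_eq0 oppr_pchar2. Qed.

Definition trace (x : F) : F := \sum_(i < n) iter i sigma x.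

Lemma iter_sigmaD i : {morph iter i sigma : x y / x + y}.
Proof. by move=> x y; elim: i => //= i ->; rewrite rmorphD. Qed.

Lemma traceD : {morph trace : x y / x + y}.
Proof.
move=> x y; rewrite /trace -big_split /=.
by apply: eq_bigr => i _; rewrite iter_sigmaD.
Qed.

Lemma trace_sigma x : trace (sigma x) = trace x.
Proof.
rewrite /trace; case: n n_odd iter_sigma => // n' _ hn.
rewrite big_ord_recr big_ord_recl /= -iterSr hn addrC; congr (_ + _).
by apply: eq_bigr => i _; rewrite -iterSr.
Qed.

Lemma sigma_trace x : sigma (trace x) = trace x.
Proof.
rewrite -[RHS]trace_sigma /trace rmorph_sum.
by apply: eq_bigr => i _; rewrite -iterS iterSr.
Qed.

Lemma traceZ t x : sigma t = t -> trace (t * x) = t * trace x.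
Proof.
move=> ht; rewrite /trace big_distrr /=; apply: eq_bigr => i _.
by elim: (val i) => //= j ->; rewrite rmorphM ht.
Qed.

Lemma trace1 : trace 1 = 1.
Proof.
rewrite /trace (eq_bigr (fun _ => 1)) => [|i _].
  rewrite sumr_const card_ord -[n]odd_double_half n_odd -muln2.
  by rewrite mulrnDr mulnC mulrnA two_eq0 mul0rn addr0.
by elim: (val i) => //= j ->; rewrite rmorph1.
Qed.

Lemma trace_fixed t : sigma t = t -> trace t = t.
Proof. by move=> ht; rewrite -[t in LHS]mulr1 traceZ // trace1 mulr1. Qed.

(* Additive Hilbert 90; as [n] is odd, the sum of the odd-indexed conjugates
   of [e] is an explicit solution. *)
Lemma trace0_solvable e : trace e = 0 -> exists y, sigma y + y = e.
Proof.
move=> he; exists (\sum_(i < n./2) iter i.*2.+1 sigma e).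
have key j : \sum_(i < j.*2.+1) iter i sigma e =
    e + (sigma (\sum_(i < j) iter i.*2.+1 sigma e) +
         \sum_(i < j) iter i.*2.+1 sigma e).
  elim: j => [|j IH]; first by rewrite big_ord1 !big_ord0 rmorph0 !addr0.
  rewrite doubleS 2!big_ord_recr IH /= !big_ord_recr /= rmorphD /=; ring.
have n_half : n./2.*2.+1 = n by rewrite -[RHS]odd_double_half n_odd.
have := key n./2; rewrite n_half.
move=> tr_e; move/eqP: he; rewrite /trace tr_e.
by rewrite addr_eq0_char2 eq_sym => /eqP.
Qed.

(** * Prescribing two traces at once *)

Lemma sigma_surj x : exists y, sigma y = x.
Proof.
exists (iter n.-1 sigma x); rewrite -iterS prednK ?iter_sigma //.
by case: n n_odd.
Qed.

(** In [1 + v + sigma v] the last two terms have equal traces, so the trace is 1 for every [v]. With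
    [sigma alpha = beta], the trace of [beta * sigma v] is that of [alpha * v]; hence [v] only has
    to make [(alpha + beta) * v] equal to the fixed element [1 + trace beta]. *)
Lemma trace_nonfixed_pair beta : sigma beta != beta ->
  exists x, trace x = 1 /\ trace (beta * x) = 1.
Proof.
have [alpha ha] := sigma_surj beta => hb.
have nz : alpha + beta != 0.
  by apply: contraNneq hb => /eqP; rewrite addr_eq0_char2 -{3}ha => /eqP <-.
pose v := (1 + trace beta) / (alpha + beta).
exists (1 + (v + sigma v)); split.
  rewrite !traceD trace_sigma trace1.
  by rewrite (addrr_pchar2 char2) addr0.
have -> : beta * (1 + (v + sigma v)) = beta + beta * v + sigma (alpha * v).
  by rewrite rmorphM /= ha; ring.
rewrite traceD trace_sigma traceD -addrA -traceD.
have -> : beta * v + alpha * v = 1 + trace beta by rewrite /v; field.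
rewrite (@trace_fixed (1 + _)); last by rewrite rmorphD rmorph1 /= sigma_trace.
by rewrite addrCA (addrr_pchar2 char2) addr0.
Qed.

Lemma trace_pair A B : A != 0 -> (A == B) || (sigma A * B != A * sigma B) ->
  exists x, trace (A * x) = 1 /\ trace (B * x) = 1.
Proof.
move=> A0 /orP[/eqP <-|hAB]; first by exists A^-1; rewrite mulfV // trace1.
have sA0 : sigma A != 0 by rewrite fmorph_eq0.
have [|x [h1 h2]] := @trace_nonfixed_pair (B / A).
  apply: contraNneq hAB; rewrite fmorph_div /= => h.
  apply/eqP; have -> : sigma B = sigma A * (sigma B / sigma A) by field.
  by rewrite h; field.
exists (x / A); split; [rewrite -h1|rewrite -h2]; congr trace; field => //.
Qed.

(** * Collisions of the twisted map *)

Definition twisted (a b c d : F) (p : F * F) : F * F :=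
  (p.1 * sigma p.1 + a * p.1 + b * p.2, p.2 * sigma p.2 + c * p.1 + d * p.2).

(** Replacing [y] by [s * y] and dividing by [s * sigma s] turns the equation into
    [sigma y + y = 1 + e / (s * sigma s)], whose right-hand side has trace 0. *)
Lemma increment_solvable s e : s != 0 -> trace (e / (s * sigma s)) = 1 ->
  exists y, (y + s) * sigma (y + s) + e = y * sigma y.
Proof.
move=> s0 he; have ss0 : sigma s != 0 by rewrite fmorph_eq0.
have [|y hy] := @trace0_solvable (1 + e / (s * sigma s)).
  by rewrite traceD trace1 he (addrr_pchar2 char2).
exists (s * y).
have -> : e = s * sigma s * (sigma y + y - 1).
  by rewrite hy; field; rewrite s0 ss0.
rewrite rmorphD !rmorphM /=; apply/eqP; rewrite -subr_eq0; apply/eqP.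
transitivity (2%:R * (s * sigma s * (sigma y + y))); first by ring.
by rewrite two_eq0 mul0r.
Qed.

Lemma collision a b c d s t y z : (s != 0) || (t != 0) ->
  (y + s) * sigma (y + s) + (a * s + b * t) = y * sigma y ->
  (z + t) * sigma (z + t) + (c * s + d * t) = z * sigma z ->
  ~ injective (twisted a b c d).
Proof.
move=> st0 hy hz inj; have /inj [] : twisted a b c d (y + s, z + t) =
    twisted a b c d (y, z).
  by rewrite /twisted /= -hy -hz; congr (_, _); ring.
move=> /eqP; rewrite -subr_eq0 addrAC subrr add0r => /eqP s0 /eqP.
rewrite -subr_eq0 addrAC subrr add0r => /eqP t0.
by rewrite s0 t0 eqxx in st0.
Qed.

Lemma trace_div_sigma e : e != 0 ->
  exists2 s, s != 0 & trace (e * s / (s * sigma s)) = 1.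
Proof.
move=> e0; have [s hs] := sigma_surj e.
have s0 : s != 0 by rewrite -(fmorph_eq0 sigma) hs.
by exists s => //; rewrite hs -[RHS]trace1; congr trace; field; rewrite e0.
Qed.

(** When [c = 0], an increment [(s, 0)] leaves the second coordinate of the image unchanged, so only
    one trace condition remains. *)
Lemma collision_c0 a b d : a != 0 -> ~ injective (twisted a b 0 d).
Proof.
move=> /trace_div_sigma[s s0] /(increment_solvable s0)[y hy].
apply: (@collision _ _ _ _ s 0 y 0); rewrite ?s0 //.
- by rewrite mulr0 addr0.
- by rewrite !(mulr0, mul0r, addr0).
Qed.

Lemma collision_b0 a c d : d != 0 -> ~ injective (twisted a 0 c d).
Proof.
move=> /trace_div_sigma[s s0] /(increment_solvable s0)[y hy].
apply: (@collision _ _ _ _ 0 s 0 y); rewrite ?s0 ?orbT //.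
- by rewrite !(mulr0, mul0r, addr0).
- by rewrite mulr0 add0r.
Qed.

(* Along [t = s * w] both solvability conditions are linear in [1 / sigma s]. *)
Lemma collision_ratio a b c d w :
  let A := a + b * w in let B := (c + d * w) / (w * sigma w) in
  w != 0 -> A != 0 -> (A == B) || (sigma A * B != A * sigma B) ->
  ~ injective (twisted a b c d).
Proof.
move=> A B w0 A0 /(trace_pair A0)[x [hA hB]].
have x0 : x != 0.
  apply: contraTneq (oner_neq0 F) => x0.
  by rewrite -hA x0 mulr0 trace_fixed ?rmorph0 // eqxx.
have [s hs] := sigma_surj x^-1.
have s0 : s != 0 by rewrite -(fmorph_eq0 sigma) hs invr_eq0.
have sw0 : sigma w != 0 by rewrite fmorph_eq0.
have [|y hy] := @increment_solvable s (a * s + b * (s * w)) s0.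
  by rewrite -hA hs /A; congr trace; field; rewrite x0 s0.
have [||z hz] := @increment_solvable (s * w) (c * s + d * (s * w)).
- by rewrite mulf_neq0.
- by rewrite -hB rmorphM /= hs /B; congr trace; field; rewrite ?s0 ?x0 ?w0 ?sw0.
by apply: (collision _ hy hz); rewrite s0.
Qed.

(** * Constraints forced by injectivity *)

Lemma sigma_sq_id : (forall x, sigma (sigma x) = x) -> forall x, sigma x = x.
Proof.
(* An odd iterate of an involution is the involution itself. *)
move=> h x; rewrite -[RHS]iter_sigma -[n in RHS]odd_double_half n_odd /=.
by congr (sigma _); elim: n./2 => //= j <-; rewrite h.
Qed.

(** Interpolation at three distinct nodes. All three are nonzero, since the quadratic will arise
    after cancelling a factor [u]; in characteristic 2 the three values add up to [p0]. *)
Lemma quadratic_coefs0 (p0 p1 p2 t : F) : t != 0 -> t != 1 ->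
  (forall u, u \in [:: 1; t; t + 1] -> p0 + p1 * u + p2 * u ^+ 2 = 0) ->
  [/\ p0 = 0, p1 = 0 & p2 = 0].
Proof.
move=> t0 t1 h.
have h1 := h 1 (mem_head _ _).
have ht : p0 + p1 * t + p2 * t ^+ 2 = 0 by apply: h; rewrite !inE eqxx orbT.
have htt : p0 + p1 * (t + 1) + p2 * (t + 1) ^+ 2 = 0.
  by apply: h; rewrite !inE eqxx !orbT.
have e0 : p0 = 0.
  transitivity ((p0 + p1 * 1 + p2 * 1 ^+ 2) + (p0 + p1 * t + p2 * t ^+ 2)
     + (p0 + p1 * (t + 1) + p2 * (t + 1) ^+ 2)
     - 2%:R * (p0 + p1 + p2 + p1 * t + p2 * t + p2 * t ^+ 2)); first by ring.
  by rewrite h1 ht htt two_eq0; ring.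
have tt : t * (t - 1) != 0 by rewrite mulf_neq0 // subr_eq0.
have e2 : p2 = 0.
  apply: (mulfI tt); rewrite mulr0.
  transitivity ((p0 + p1 * t + p2 * t ^+ 2) - t * (p0 + p1 * 1 + p2 * 1 ^+ 2)
    + (t - 1) * p0); first by ring.
  by rewrite ht h1 e0; ring.
by split=> //; move: h1; rewrite e0 e2 mulr1 mul0r add0r addr0.
Qed.

Lemma inj_dependent a b c d w :
  let A := a + b * w in let B := (c + d * w) / (w * sigma w) in
  injective (twisted a b c d) -> w != 0 -> A != 0 ->
  A != B /\ sigma A * B = A * sigma B.
Proof.
move=> A B inj w1 A0; split.
  by apply/negP => AB; case: (collision_ratio w1 A0 _ inj); rewrite AB.
apply/eqP/negPn/negP => E.
by case: (collision_ratio w1 A0 _ inj); rewrite E orbT.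
Qed.

(** Without denominators the relation also covers [w = 0] and [a + b * w = 0], so [w] can be
    rescaled with no side condition. *)
Lemma inj_dependent_cleared a b c d : injective (twisted a b c d) ->
  forall w, sigma (a + b * w) * (c + d * w) * sigma (sigma w) =
    (a + b * w) * sigma (c + d * w) * w.
Proof.
move=> inj w.
have [->|w1] := eqVneq w 0; first by rewrite !rmorph0 !mulr0.
have [->|A0] := eqVneq (a + b * w) 0; first by rewrite rmorph0 !mul0r.
have [_] := inj_dependent inj w1 A0.
have sw0 : sigma w != 0 by rewrite fmorph_eq0.
have ssw0 : sigma (sigma w) != 0 by rewrite fmorph_eq0.
move: (c + d * w) (a + b * w) => C A.
rewrite fmorph_div !rmorphM /= => E.
transitivity (sigma A * (C / (w * sigma w)) * (w * sigma w * sigma (sigma w))).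
  by field; rewrite w1 sw0.
by rewrite E; field; rewrite ssw0 sw0.
Qed.

Lemma dependent_fixed_field a b c d w0 : sigma w0 != w0 -> b != 0 -> c != 0 ->
  (forall w, sigma (a + b * w) * (c + d * w) * sigma (sigma w) =
    (a + b * w) * sigma (c + d * w) * w) ->
  forall t, sigma t = t -> t = 0 \/ t = 1.
Proof.
move=> hw0 b0 c0 depM t ht.
have sq_contra : ~ (forall x, sigma (sigma x) = x).
  by move=> /sigma_sq_id /(_ w0) h; rewrite h eqxx in hw0.
have sb0 : sigma b != 0 by rewrite fmorph_eq0.
have sc0 : sigma c != 0 by rewrite fmorph_eq0.
have [->|t0] := eqVneq t 0; first by left.
have [->|t1] := eqVneq t 1; first by right.
exfalso.
(* For [u] fixed by [sigma], the relation at [u * w] is [u] times the quadratic in [u] with these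
   coefficients. *)
pose p0 w := sigma a * c * sigma (sigma w) - a * sigma c * w.
pose p1 w := sigma b * sigma w * c * sigma (sigma w)
  + sigma a * d * w * sigma (sigma w) - b * w * sigma c * w
  - a * sigma d * sigma w * w.
pose p2 w := sigma b * sigma w * d * w * sigma (sigma w)
  - b * w * sigma d * sigma w * w.
have coef w : [/\ p0 w = 0, p1 w = 0 & p2 w = 0].
  apply: (@quadratic_coefs0 _ _ _ t) => // u hu.
  have [u0 su] : u != 0 /\ sigma u = u.
    move: hu; rewrite !inE => /or3P[] /eqP ->; rewrite ?rmorphD ?rmorph1 /= ?ht.
    - by rewrite oner_neq0.
    - by [].
    - by rewrite addr_eq0_char2.
  apply: (mulfI u0); rewrite mulr0.
  move/eqP: (depM (u * w)); rewrite -subr_eq0 => /eqP <-.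
  by rewrite !(rmorphD, rmorphM) /= !su /p0 /p1 /p2; ring.
(* If [a] is nonzero, [p0 1 = 0] gives [sigma a * c = a * sigma c], and cancelling this in
   [p0 x = 0] makes [sigma] an involution. The argument for [d] is the same with [p2]. *)
have a_0 : a = 0.
  apply/eqP/negPn/negP => a0; apply: sq_contra => x.
  have [/eqP e1 _ _] := coef 1; have [/eqP ex _ _] := coef x.
  move: e1 ex; rewrite /p0 !subr_eq0 !rmorph1 !mulr1 => /eqP -> /eqP.
  by apply: mulfI; rewrite mulf_neq0.
have d_0 : d = 0.
  apply/eqP/negPn/negP => d0; apply: sq_contra => x.
  have [->|x0] := eqVneq x 0; first by rewrite !rmorph0.
  have sx0 : sigma x != 0 by rewrite fmorph_eq0.
  have [_ _ /eqP e1] := coef 1; have [_ _ /eqP ex] := coef x.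
  move: e1 ex; rewrite /p2 !subr_eq0 !rmorph1 !mulr1 => /eqP e1 /eqP ex.
  have : sigma b * d * (x * sigma x) * sigma (sigma x) =
    b * sigma d * (x * sigma x) * x.
    by transitivity (sigma b * sigma x * d * x * sigma (sigma x));
      [ring | rewrite ex; ring].
  by rewrite e1; apply: mulfI; rewrite !mulf_neq0 ?fmorph_eq0.
have sq x : sigma x * sigma (sigma x) = x ^+ 2.
  have [_ /eqP e1 _] := coef 1; have [_ /eqP ex _] := coef x.
  move: e1 ex; rewrite /p1 a_0 d_0 !rmorph0 !rmorph1 !(mulr1, mul0r, mulr0).
  rewrite !(addr0, subr0) !subr_eq0 => /eqP e1 /eqP ex.
  apply: (@mulfI _ (b * sigma c)); first by rewrite mulf_neq0.
  rewrite -[in LHS]e1.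
  by transitivity (sigma b * sigma x * c * sigma (sigma x));
      [ring | rewrite ex; ring].
(* Expanding [sq] at [w0 + 1] and subtracting [sq] at [w0] leaves
   [sigma w0 + sigma (sigma w0) = 2 w0 = 0], so [sigma] fixes [sigma w0], hence [w0]. *)
case/eqP: hw0; apply/(fmorph_inj sigma)/eqP; rewrite -addr_eq0_char2; apply/eqP.
have := sq (w0 + 1); rewrite !(rmorphD, rmorph1) /= => h.
transitivity ((sigma w0 + 1) * (sigma (sigma w0) + 1)
  - sigma w0 * sigma (sigma w0) - 1); first by ring.
rewrite h sq; transitivity (2%:R * w0); first by ring.
by rewrite two_eq0 mul0r.
Qed.

Lemma affine_nonroot (a b c d w0 : F) :
  w0 != 0 -> w0 != 1 -> b != 0 -> c != 0 ->
  exists w, [/\ w != 0, a + b * w != 0 & c + d * w != 0].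
Proof.
move=> w00 w01 b0 c0.
(* Three distinct candidates cannot all lie among two roots. If [d = 0], the second entry is 0 by
   the convention for division, and [c + d * w] is then the nonzero [c]. *)
pose bad := [:: - a / b; - c / d].
have : ~~ all [in bad] [:: 1; w0; w0 + 1].
  apply/negP => /allP sub.
  suff /uniq_leq_size /(_ sub) : uniq [:: 1; w0; w0 + 1] by [].
  rewrite /= !inE negb_or.
  rewrite eq_sym w01 /= -[X in X == w0 + 1]add0r (inj_eq (addIr 1)) eq_sym w00.
  by rewrite -[X in X == w0 + 1]addr0 (inj_eq (addrI w0)) eq_sym oner_eq0.
rewrite -has_predC => /hasP[w w_in]; rewrite /= !inE negb_or => /andP[ha hc].
exists w; split.
- move: w_in; rewrite !inE => /or3P[] /eqP -> //; first exact: oner_neq0.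
  by rewrite addr_eq0_char2.
- by apply: contraNneq ha => /eqP; rewrite addrC addr_eq0 => /eqP <-;
      apply/eqP; field.
- have [->|d0] := eqVneq d 0; first by rewrite mul0r addr0.
  by apply: contraNneq hc => /eqP; rewrite addrC addr_eq0 => /eqP <-;
      apply/eqP; field.
Qed.

Lemma twisted_not_inj a b c d w0 : sigma w0 != w0 -> a * d + b * c != 0 ->
  ~ injective (twisted a b c d).
Proof.
move=> hw0 hdet inj.
have b0 : b != 0.
  apply/eqP => b0; subst b; apply: collision_b0 inj.
  by apply: contraNneq hdet => ->; rewrite mulr0 mul0r addr0.
have c0 : c != 0.
  apply/eqP => c0; subst c; apply: collision_c0 inj.
  by apply: contraNneq hdet => ->; rewrite mulr0 mul0r addr0.
have K2 := dependent_fixed_field hw0 b0 c0 (inj_dependent_cleared inj).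
have w00 : w0 != 0 by apply: contraNneq hw0 => ->; rewrite rmorph0.
have w01 : w0 != 1 by apply: contraNneq hw0 => ->; rewrite rmorph1.
have [w [w1 wA wB]] := affine_nonroot a d w00 w01 b0 c0.
have [AB E] := inj_dependent inj w1 wA.
move: AB E; set A := a + b * w in wA *; set B := _ / _ => AB E.
have sA0 : sigma A != 0 by rewrite fmorph_eq0.
(* [B / A] is fixed by [sigma], yet it is neither 0, by the choice of [w], nor 1, as [A != B]. *)
have [||/eqP] := K2 (B / A).
- rewrite fmorph_div; apply/eqP; rewrite eqr_div //; apply/eqP.
  by rewrite mulrC -E mulrC.
- by apply/eqP; rewrite !(mulf_eq0, invr_eq0) fmorph_eq0 !negb_or wB w1 wA.
- by rewrite -(inj_eq (mulIf wA)) divfK // mul1r eq_sym (negPf AB).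
Qed.

End TwistedMap.

(** * Specialization to a Frobenius power on a finite field *)

Theorem proposition3p1 (m k : nat) (F : finFieldType) (a b c d : F)
  (hk : (1 <= k <= m - 1)%N)
  (hF : #|F| = (2 ^ m)%N)
  (hodd : odd (m %/ gcdn m k))
  (hdet : a * d + b * c != 0) :
  ~ bijective (Gmap (2 ^ k) a b c d).
Proof.
have char2 : 2%N \in [pchar F] by exact: card_finPcharP hF _.
have powD : {morph (fun x : F => x ^+ (2 ^ k)) : x y / x + y}.
  move=> x y; apply: exprDn_pchar.
  by rewrite pnatX pnatE ?char2.
pose frob (x : F) := x ^+ (2 ^ k).
have frob_zmod : zmod_morphism frob.
  by move=> x y; rewrite /frob !(oppr_pchar2 char2) powD.
have frob_monoid : monoid_morphism frob.
  by split=> [|x y]; rewrite /frob ?expr1n ?exprMn.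
pose sigma : {rmorphism F -> F} := HB.pack frob
  (GRing.isZmodMorphism.Build F F frob frob_zmod)
  (GRing.isMonoidMorphism.Build F F frob frob_monoid).
have iter_frob j x : iter j sigma x = x ^+ (2 ^ (k * j)).
  elim: j => [|j IH]; first by rewrite muln0 expr1.
  by rewrite iterS IH /= /frob -exprM -expnD mulnS addnC.
have iter_card j (x : F) : x ^+ (2 ^ (m * j)) = x.
  elim: j => [|j IH]; first by rewrite muln0 expr1.
  by rewrite mulnS addnC expnD exprM IH -hF expf_card.
(* With [g = gcdn m k], [k * (m / g) = m * (k / g)], so this iterate is a power of the trivial map
   [x ^+ (2 ^ m)]. *)
have sigma_order x : iter (m %/ gcdn m k) sigma x = x.
  rewrite iter_frob muln_divA ?dvdn_gcdl // [(k * m)%N]mulnC.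
  by rewrite -muln_divA ?dvdn_gcdr // iter_card.
(* Otherwise ['X^(2 ^ k) - 'X] would have [2 ^ m] roots, more than its degree. *)
have [w0 hw0] : exists w0, sigma w0 != w0.
  have lt_km : (k < m)%N by lia.
  have [/existsP //|/existsPn h] := boolP [exists w0, sigma w0 != w0].
  pose p : {poly F} := 'X^(2 ^ k) - 'X.
  have szp : size p = (2 ^ k).+1.
    by rewrite size_polyDl size_polyXn // size_polyN size_polyX
      ltnS (ltn_exp2l 0) //; case/andP: hk.
  have p0 : p != 0 by rewrite -size_poly_eq0 szp.
  have rp : all (root p) (enum F).
    apply/allP => x _; rewrite /root !hornerE subr_eq0.
    by move: (h x); rewrite negbK.
  have := max_poly_roots p0 rp (enum_uniq F).
  by rewrite szp -cardE hF ltnS leqNgt ltn_exp2l // lt_km.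
move=> /bij_inj inj.
have := twisted_not_inj char2 hodd sigma_order hw0 hdet; apply=> p p' e.
by apply: inj; move: e; rewrite /twisted /Gmap !addn1 !exprS.
Qed.
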